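(* Let $X_1,\dots,X_n$ be nonempty compact metric spaces and, for each pair $(i,j)\in\{1,\dots,n\}^2$, let $F_{ij}$ be a compact admissible family of contractions (possibly empty) from $X_j$ to $X_i$. Assume that each $F_{ij}$ is equipped with a positive (finite, regular) Borel measure $\sigma_{ij}$ and define $s_{ij}=\sigma_{ij}(F_{ij})$, with $s_{ij}:=0$ if $F_{ij}$ is empty. Assume that the matrix $\boldsymbol{s}:=(s_{ij})$ has a $1$-eigenvector $\boldsymbol{m}=(m_1,\dots,m_n)^T$ with all entries strictly positive, i.e. $\boldsymbol{s}\boldsymbol{m}=\boldsymbol{m}$. Then there exists a unique family of positive regular Borel measures $\omega_i$ on $X_i$ with $\omega_i(X_i)=m_i$, $i=1,\dots,n$, which satisfy $$\omega_i=\sum_{j=1}^n\int_{F_{ij}}(f.\omega_j)\,\mathrm{d}\sigma_{ij}(f),\qquad i=1,\dots,n.$$ The support of the product measure $\omega=\omega_1\otimes\dots\otimes\omega_n$ is contained in the attractor $W=W_1\times\dots\times W_n$ of the system $(F_{ij})$.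
   Context: A compact admissible family of contractions from a metric space $Y$ to a metric space $X$ is a subset $G$ of $C(Y,X)$, compact in the compact-open topology, consisting of Lipschitz maps whose Lipschitz constants are bounded by a common $r<1$. For $f:X_j\to X_i$ and a measure $\mu$ on $X_j$, $f.\mu$ is the push-forward: $(f.\mu)(\phi)=\mu(\phi\circ f)$, where $\mu(\phi)=\int\phi\,\mathrm{d}\mu$. The integral $\int_{F_{ij}}(f.\omega_j)\,\mathrm{d}\sigma_{ij}(f)$ is the measure on $X_i$ given by $\phi\mapsto\int_{F_{ij}}\omega_j(\phi\circ f)\,\mathrm{d}\sigma_{ij}(f)$, $\phi\in C(X_i,\mathbb{R})$; it is $0$ if $F_{ij}=\emptyset$. The attractor is the unique tuple of nonempty compact sets $W_i\subset X_i$ (identified with $W_1\times\dots\times W_n$) with $W_i=\bigcup_{j=1}^n\bigcup_{f\in F_{ij}}f(W_j)$ for $i=1,\dots,n$. (Under the hypothesis on $\boldsymbol{s}$, for every $i$ some $F_{ij}$ is nonempty.) *)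

(* Defs.v *)
From HB Require Import structures.
From mathcomp Require Import all_boot all_order all_algebra.
From mathcomp Require Import all_classical all_reals all_analysis.

Set Implicit Arguments.
Unset Strict Implicit.
Unset Printing Implicit Defensive.

Import Order.TTheory GRing.Theory Num.Theory.
Import numFieldNormedType.Exports.

Local Open Scope classical_set_scope.
Local Open Scope ring_scope.

(* The library has metric spaces and pointed pseudometric spaces, but not their
   join. A point is needed because every measurableType is pointed. *)
#[short(type="pmetricType")]
HB.structure Definition PointedMetric (R : numDomainType) :=
  { M of Metric R M & Pointed M }.

(* C(Y, X) with the compact-open topology. *)
Definition cspace (Y X : topologicalType) : Type := continuousType Y X.

Definition cspace_fun (Y X : topologicalType) (f : cspace Y X) :
  {compact-open, Y -> X} := (f : continuousType Y X).
Coercion cspace_fun : cspace >-> compact_open.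

HB.instance Definition _ (Y X : topologicalType) :=
  Topological.copy (cspace Y X) (initial_topology (@cspace_fun Y X)).
HB.instance Definition _ (Y : topologicalType) (X : ptopologicalType) :=
  isPointed.Build (cspace Y X) (cst point : continuousType Y X).

(* Compact admissible family of contractions, possibly empty. *)
Definition admissible (R : realType) (Y X : pmetricType R)
    (G : set (cspace Y X)) : Prop :=
  compact G /\
  exists2 r : R, 0 <= r < 1 &
    forall f, G f -> forall x y, mdist (f x) (f y) <= r * mdist x y.

Definition borel (T : ptopologicalType) := g_sigma_algebraType (@open T).

Definition regular_measure (R : realType) (T : ptopologicalType)
    (mu : {measure set (borel T) -> \bar R}) : Prop :=
  forall A : set (borel T), measurable A ->
    mu A = ereal_inf [set mu U | U in [set U : set T | open U /\ A `<=` U]] /\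
    mu A = ereal_sup [set mu K | K in [set K : set T | compact K /\ K `<=` A]].

Definition box (I : Type) (T : I -> Type) (A : forall i, set (T i)) :
  set (forall i, T i) := [set x | forall i, A i (x i)].

Section product_measure.
Context (R : realType) (n : nat) (d : 'I_n -> measure_display)
  (T : forall i, measurableType (d i)).

Definition measurable_boxes : set (set (forall i, T i)) :=
  [set box A | A in [set A : forall i, set (T i) | forall i, measurable (A i)]].

Definition prod_salgebraType := g_sigma_algebraType measurable_boxes.

Definition is_product_measure
    (mu : forall i, {finite_measure set (T i) -> \bar R})
    (P : {finite_measure set prod_salgebraType -> \bar R}) : Prop :=
  forall A : forall i, set (T i), (forall i, measurable (A i)) ->
    P (box A) = (\prod_(i < n) mu i (A i))%E.

Let upd (k : 'I_n) (z : prod_salgebraType * T k) : prod_salgebraType :=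
  dfwith z.1 k z.2.

Let upd_box k (A : forall i, set (T i)) :
  @upd k @^-1` box A = box (dfwith A k setT) `*` A k.
Proof.
apply/seteqP; split => -[x y] /=.
- move=> xyA; split; last by have := xyA k; rewrite /upd dfwithin.
  move=> i; have := xyA i; rewrite /upd/=.
  by case: dfwithP => [|j kj]; rewrite ?dfwithin// dfwithout.
- move=> [xA yA] i; rewrite /upd/=; case: dfwithP => // j kj.
  by have := xA j; rewrite dfwithout.
Qed.

Let measurable_dfwith k (A : forall i, set (T i)) :
  (forall i, measurable (A i)) -> forall i, measurable (dfwith A k setT i).
Proof. by move=> mA i; case: dfwithP => // j kj. Qed.

Let measurable_box (A : forall i, set (T i)) :
  (forall i, measurable (A i)) -> measurable (box A : set prod_salgebraType).
Proof. by move=> mA; apply: sub_sigma_algebra; exists A. Qed.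

Let measurable_upd k : measurable_fun setT (@upd k).
Proof.
apply: (@measurability _ _ _ prod_salgebraType _ _ measurable_boxes) => //.
move=> _ [_ [A /= mA <-] <-]; rewrite setTI upd_box.
by apply: measurableX => //; apply: measurable_box; exact: measurable_dfwith.
Qed.

Section step.
Variables (P : {finite_measure set prod_salgebraType -> \bar R}) (k : 'I_n)
  (muk : {finite_measure set (T k) -> \bar R}).

Let Q (A : set prod_salgebraType) : \bar R := (P \x muk)%E (@upd k @^-1` A).

Let Q0 : Q set0 = 0%E.
Proof. by rewrite /Q preimage_set0 measure0. Qed.

Let Q_ge0 A : (0 <= Q A)%E.
Proof. exact: measure_ge0. Qed.

Let Q_sigma_additive : semi_sigma_additive Q.
Proof.
have mpre B : measurable B -> measurable (@upd k @^-1` B).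
  by move=> mB; rewrite -[X in measurable X]setTI; exact: measurable_upd.
move=> F mF tF mUF; rewrite /Q preimage_bigcup.
apply: measure_semi_sigma_additive.
- by move=> i; exact: mpre.
- apply/trivIsetP => /= i j _ _ ij; rewrite -preimage_setI.
  by move/trivIsetP : tF => /(_ _ _ _ _ ij) ->//; rewrite preimage_set0.
- by rewrite -preimage_bigcup; exact: mpre.
Qed.

Let Q_isMeasure := isMeasure.Build _ _ _ Q Q0 Q_ge0 Q_sigma_additive.
Let Qm : {measure set prod_salgebraType -> \bar R} := HB.pack Q Q_isMeasure.

Let Q_fin : fin_num_fun Qm.
Proof.
apply: lty_fin_num_fun; rewrite /= /Q preimage_setT -setXTT product_measure1E//.
by rewrite ltey_eq fin_numM// fin_num_measure.
Qed.

Let Q_isFinite := Measure_isFinite.Build _ _ _ Qm Q_fin.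
Let Qf : {finite_measure set prod_salgebraType -> \bar R} :=
  HB.pack Q Q_isMeasure Q_isFinite.

Local Lemma product_measure_step :
  exists P' : {finite_measure set prod_salgebraType -> \bar R},
  forall A : forall i, set (T i), (forall i, measurable (A i)) ->
    P' (box A) = (P (box (dfwith A k setT)) * muk (A k))%E.
Proof.
exists Qf => A mA; rewrite /= /Q upd_box product_measure1E//.
by apply: measurable_box; exact: measurable_dfwith.
Qed.

End step.

Lemma product_measure_exists
    (mu : forall i, {finite_measure set (T i) -> \bar R}) :
  exists P, is_product_measure mu P.
Proof.
pose nu (s : seq 'I_n) i (A : set (T i)) : \bar R :=
  if i \in s then mu i A else \d_(point : T i) A.
suff [P PE] : exists P : {finite_measure set prod_salgebraType -> \bar R},
    forall A : forall i, set (T i), (forall i, measurable (A i)) ->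
    P (box A) = (\prod_(i < n) nu (enum 'I_n) i (A i))%E.
  by exists P => A /PE ->; apply: eq_bigr => i _; rewrite /nu mem_enum.
elim: (enum 'I_n) (enum_uniq 'I_n) => [_|k s IH /= /andP[ks /IH[P PE]]].
  exists (\d_(point : prod_salgebraType)) => A mA; rewrite /nu /=.
  rewrite diracE; have [pA|pA] := boolP (point \in _).
    rewrite big1// => i _; rewrite diracE mem_set//.
    by move: pA; rewrite inE => /(_ i).
  have [i npA] : exists i, ~ A i point.
    by apply/existsNP => h; move: pA; rewrite notin_setE; apply.
  by rewrite (bigD1 i)//= diracE memNset// mul0e.
have [Q QE] := product_measure_step P (mu k).
exists Q => A mA; rewrite QE// PE; last exact: measurable_dfwith.
rewrite (bigD1 k)//= [RHS](bigD1 k)//= dfwithin.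
rewrite {1}/nu (negbTE ks) diracE in_setT mul1e muleC /nu mem_head.
congr (_ * _)%E; apply: eq_bigr => i ik.
by rewrite dfwithout 1?eq_sym// inE (negbTE ik).
Qed.

(* Uniquely determined by is_product_measure, since the boxes form a pi-system
   that generates the sigma-algebra and contains the whole space. *)
Definition product_measure
    (mu : forall i, {finite_measure set (T i) -> \bar R}) :
  {finite_measure set prod_salgebraType -> \bar R} :=
  sval (cid (product_measure_exists mu)).

Lemma product_measureE (mu : forall i, {finite_measure set (T i) -> \bar R}) :
  is_product_measure mu (product_measure mu).
Proof. exact: svalP (cid (product_measure_exists mu)). Qed.

End product_measure.

(* For a Borel measure on a second countable space, this is the complement of
   the largest open null set. It applies to product_measure on a product of
   compact metric spaces: by second countability, the open sets of
   prod_topology belong to the product sigma-algebra. *)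
Definition msupport (R : realType) (T : topologicalType)
    (mu : set T -> \bar R) : set T :=
  [set x | forall U : set T, open U -> U x -> (0 < mu U)%E].

Definition is_attractor (R : realType) (n : nat) (X : 'I_n -> pmetricType R)
    (F : forall i j : 'I_n, set (cspace (X j) (X i)))
    (W : forall i, set (X i)) : Prop :=
  forall i, [/\ W i !=set0, compact (W i) &
    W i = \bigcup_(j in [set: 'I_n]) \bigcup_(f in F i j) (f @` W j)].

(* Measures on X_i are compared through the integrals of continuous functions,
   which is how the measure \int_(F i j) f.omega_j dsigma_ij(f) is defined. *)
Definition is_invariant (R : realType) (n : nat) (X : 'I_n -> pmetricType R)
    (F : forall i j : 'I_n, set (cspace (X j) (X i)))
    (sigma : forall i j : 'I_n,
      {finite_measure set (borel (cspace (X j) (X i))) -> \bar R})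
    (omega : forall i, {finite_measure set (borel (X i)) -> \bar R}) : Prop :=
  forall i (phi : X i -> R), continuous phi ->
    (\int[omega i]_x (phi x)%:E =
     \sum_(j < n) \int[sigma i j]_(f in F i j) \int[omega j]_x (phi (f x))%:E)%E.

(* Main.v *)
(* Test a tuple of measures against continuous functions: the invariance
   equation then says that the tuple of functionals is a fixed point of an
   operator on tuples (L_i) of positive functionals with L_i(1) = m_i. Measure
   the distance between two such tuples by the least c with
   |L_i(phi) - L'_i(phi)| <= c K m_i for all i and all K-Lipschitz phi: since
   phi o f is rK-Lipschitz for f in F_ij and s m = m, the operator contracts
   distances by r. This gives uniqueness, and existence of a fixed tuple of
   functionals as a limit of iterates, which the Riesz representation theorem
   turns into measures. The same contraction estimate shows that an invariant
   tuple annihilates the Lipschitz functions that vanish on the attractor. *)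
From HB Require Import structures.
Require Import Defs.
From mathcomp Require Import all_boot all_order all_algebra.
From mathcomp Require Import all_classical all_reals all_analysis.
From mathcomp Require Import measurable_realfun ring lra.

Set Implicit Arguments.
Unset Strict Implicit.
Unset Printing Implicit Defensive.

Import Order.TTheory GRing.Theory Num.Theory.
Import numFieldNormedType.Exports.

Local Open Scope classical_set_scope.
Local Open Scope ring_scope.

(** * Lipschitz functions and the distance to a set *)

Section lipschitz_functions.
Context {R : realType} {T : metricType R}.
Implicit Types (A U : set T) (x y : T) (phi : T -> R).

Definition lip (K : R) phi := forall x y, `|phi x - phi y| <= K * mdist x y.

Lemma lip_continuous K phi : lip K phi -> continuous phi.
Proof.
move=> lipphi x; apply/cvgrPdist_le => e e0.
have K0 : 0 < `|K| + 1 by rewrite ltr_wpDl.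
have : \forall y \near x, ball x (e / (`|K| + 1)) y.
  by apply: nbhsx_ballx; rewrite divr_gt0.
apply: filterS => y; rewrite ballEmdist /= => xy.
apply: le_trans (lipphi x y) _; apply: (@le_trans _ _ ((`|K| + 1) * mdist x y)).
  by rewrite ler_wpM2r ?mdist_ge0// (le_trans (ler_norm K))// lerDl.
by rewrite mulrC -ler_pdivlMr// ltW.
Qed.

Definition setdist A x : R := inf [set mdist x a | a in A].

Let has_lb_mdist A x : has_lbound [set mdist x a | a in A].
Proof. by exists 0 => _ [a _ <-]; exact: mdist_ge0. Qed.

Lemma setdist_le A x a : A a -> setdist A x <= mdist x a.
Proof. by move=> Aa; apply: ge_inf => //; exists a. Qed.

Lemma le_setdist A x c :
  A !=set0 -> (forall a, A a -> c <= mdist x a) -> c <= setdist A x.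
Proof.
move=> [a Aa] cA; apply: lb_le_inf; first by exists (mdist x a), a.
by move=> _ [b Ab <-]; exact: cA.
Qed.

Lemma setdist_ge0 A x : A !=set0 -> 0 <= setdist A x.
Proof. by move=> A0; apply: le_setdist => // a _; exact: mdist_ge0. Qed.

Lemma setdist_eq0 A x : A x -> setdist A x = 0.
Proof.
move=> Ax; apply/eqP; rewrite eq_le -{1}(mdistxx x) setdist_le//=.
by apply: setdist_ge0; exists x.
Qed.

Lemma setdist_lip A : A !=set0 -> lip 1 (setdist A).
Proof.
move=> A0.
suff D x y : setdist A x - setdist A y <= mdist x y.
  by move=> x y; rewrite mul1r ler_norml D lerNl opprB metric_sym D.
rewrite lerBlDl -lerBlDr; apply: le_setdist => // a Aa.
by rewrite lerBlDr (le_trans (setdist_le _ Aa))// addrC metric_triangle.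
Qed.

Lemma setdist_gt0 A x : closed A -> A !=set0 -> ~ A x -> 0 < setdist A x.
Proof.
move=> cA A0 nAx.
have /nbhs_ballP[e /= e0 eA] : nbhs x (~` A).
  by apply: open_nbhs_nbhs; split => //; exact: closed_openC.
apply: lt_le_trans e0 _; apply: le_setdist => // a Aa.
by rewrite leNgt; apply/negP => xa; apply: (eA a) => //; rewrite ballEmdist.
Qed.

(** The functions are the minima of 1 and [n] times the distance to the complement of [U]. At a
    point of [U] they equal 1 from some index on, rather than only in the limit; [covers_split]
    relies on this. *)
Lemma lip_open_approx U : open U -> exists u : nat -> T -> R,
  [/\ (forall n, lip n%:R (u n)), (forall n x, 0 <= u n x <= 1),
      (forall n m x, (n <= m)%N -> u n x <= u m x),
      (forall n x, ~ U x -> u n x = 0) &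
      (forall x, U x -> exists N, forall n, (N <= n)%N -> u n x = 1)].
Proof.
(* When [U] is the whole space, the distance to its complement is an infimum over the empty set, 0
   by convention, so the formula below would fail. *)
move=> oU; have [UT|/set0P U0] := eqVneq (~` U) set0.
  exists (fun _ _ => 1); split => //.
  - by move=> n x y; rewrite subrr normr0 mulr_ge0 ?mdist_ge0.
  - by move=> n x; rewrite ler01 lexx.
  - by move=> n x nUx; have : (~` U) x by []; rewrite UT.
  - by move=> x _; exists 0%N.
have d0 x := setdist_ge0 x U0.
exists (fun n x => Num.min 1 (n%:R * setdist (~` U) x)); split.
- move=> n x y; apply: (@le_trans _ _ `|n%:R * setdist (~` U) x -
      n%:R * setdist (~` U) y|).
    rewrite /Num.min; case: ltrP => a; case: ltrP => b;
    rewrite ler_norml; have := ler_norm (n%:R * setdist (~` U) x -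
      n%:R * setdist (~` U) y); have := ler_norm (- (n%:R * setdist (~` U) x -
      n%:R * setdist (~` U) y)); rewrite normrN; lra.
  rewrite -mulrBr normrM normr_nat ler_wpM2l//.
  by have := setdist_lip U0 x y; rewrite mul1r.
- by move=> n x; rewrite le_min ler01 mulr_ge0//= ge_min lexx.
- move=> n m x nm; rewrite le_min ge_min lexx/= ge_min.
  by rewrite ler_wpM2r ?orbT// ler_nat.
- move=> n x nUx; rewrite setdist_eq0// mulr0; apply/min_idPr; exact: ler01.
- move=> x Ux; have sx : 0 < setdist (~` U) x.
    by apply: setdist_gt0 => //; exact: open_closedC.
  (* From the inverse of the distance between [x] and the complement onwards, the minimum is 1. *)
  exists (Num.truncn (setdist (~` U) x)^-1).+1 => n Nn.
  apply/min_idPl; rewrite -ler_pdivrMr// mul1r.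
  by rewrite ltW// (lt_le_trans (truncnS_gt _))// ler_nat.
Qed.

End lipschitz_functions.

(** * Continuous functions on a compact metric space *)

Section compact_metric.
Context {R : realType} {T : metricType R}.
Hypothesis compactT : compact [set: T].

Lemma compact_bound (phi : T -> R) :
  continuous phi -> exists2 M, 0 <= M & forall x, `|phi x| <= M.
Proof.
move=> cphi; have : compact (phi @` [set: T]).
  by apply: continuous_compact => //; exact: continuous_subspaceT.
move=> /compact_bounded[M [Mr MP]]; exists (`|M| + 1) => [|x].
  by rewrite addr_ge0.
apply: MP; last by exists x.
by rewrite (le_lt_trans (ler_norm _))// ltrDl.
Qed.

Lemma compact_diam : exists2 D : R, 0 <= D & forall x y : T, mdist x y <= D.
Proof.
have [[p _]|nT] := pselect ([set: T] !=set0); last first.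
  by exists 0 => // x y; exfalso; apply: nT; exists x.
have lipp : lip 1 (mdist p).
  move=> x y; rewrite mul1r ler_norml.
  have := metric_triangle p x y; have := metric_triangle p y x.
  rewrite (metric_sym y x); lra.
have [M M0 MP] := compact_bound (lip_continuous lipp).
exists (M + M) => [|x y]; first by rewrite addr_ge0.
have := metric_triangle x p y; have := MP x; have := MP y.
rewrite (metric_sym x p) !ger0_norm ?mdist_ge0//; lra.
Qed.

(* psi is the inf-convolution of phi with K * mdist. *)
Lemma lip_dense (phi : T -> R) (e : R) : continuous phi -> 0 < e ->
  exists K psi, [/\ 0 <= K, lip K psi & forall x, `|phi x - psi x| <= e].
Proof.
move=> cphi e0.
(* Uniform continuity of [phi], by the near-covering form of compactness: with half radii, [y] and
   [z] both lie in the ball chosen around [x]. *)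
have [d d0 dP] : exists2 d, 0 < d &
    forall x y : T, mdist x y < d -> phi x - phi y <= e.
  have : \forall d \near 0^'+, forall x, [set: T] x ->
      forall y, mdist x y < d -> phi x - phi y <= e.
    move/compact_near_coveringP : compactT; apply => x _.
    have e20 : 0 < e / 2 by rewrite divr_gt0.
    have /cvgrPdist_lt/(_ _ e20)/nbhs_ballP[d /= d0 dP] := cphi x.
    exists (ball x (d / 2), [set c | c < d / 2]).
      split; first by apply: nbhsx_ballx; rewrite divr_gt0.
      by apply: nbhs_right_lt; rewrite divr_gt0.
    move=> [y c] /= [xy cd] z yz.
    have xyd : mdist x y < d / 2 by move: xy; rewrite ballEmdist.
    have /dP : ball x d y by rewrite ballEmdist /=; lra.
    have /dP : ball x d z.
      by rewrite ballEmdist /=; have := metric_triangle x y z; lra.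
    by rewrite /= !ltr_norml; lra.
  move=> dn; near (0:R)^'+ => d; exists d => // x y.
  by have := near dn d; apply.
have [M M0 MP] := compact_bound cphi.
(* Then [K * d] is [M + M], which bounds the oscillation of [phi]: points at distance at least [d]
   cannot bring the infimum below [phi x]. *)
pose K := (M + M) / d.
have K0 : 0 <= K by rewrite divr_ge0// ?addr_ge0// ltW.
pose S x := [set phi y + K * mdist x y | y in [set: T]].
have S0 x : S x !=set0 by exists (phi x + K * mdist x x), x.
have Slb x : has_lbound (S x).
  exists (- M) => _ [y _ <-]; have := MP y; rewrite ler_norml => /andP[My _].
  by rewrite (le_trans My)// lerDl mulr_ge0// mdist_ge0.
exists K, (fun x => inf (S x)); split => //.
  suff D x y : inf (S x) - inf (S y) <= K * mdist x y.
    by move=> x y; rewrite ler_norml D lerNl opprB metric_sym D.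
  rewrite lerBlDl -lerBlDr; apply: lb_le_inf => // _ [z _ <-].
  rewrite lerBlDr; apply: (@le_trans _ _ (phi z + K * mdist x z)).
    by apply: ge_inf => //; exists z.
  by rewrite -addrA lerD2l -mulrDr ler_wpM2l// addrC metric_triangle.
move=> x; have Sx : inf (S x) <= phi x.
  by apply: ge_inf => //; exists x => //; rewrite mdistxx mulr0 addr0.
suff : phi x - e <= inf (S x) by rewrite ler_norml; lra.
apply: lb_le_inf => // _ [y _ <-].
have := MP y; have := MP x; rewrite !ler_norml => xM yM.
have [/dP|dxy] := ltP (mdist x y) d.
  by have := mulr_ge0 K0 (mdist_ge0 x y); lra.
have : K * d <= K * mdist x y by rewrite ler_wpM2l.
by rewrite /K -mulrA mulVf ?gt_eqF// mulr1; lra.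
Unshelve. all: by end_near. Qed.

End compact_metric.

(** * Borel measures and continuous functions *)

Section borel_measures.
Context {R : realType} {T : ptopologicalType}.

Lemma borel_open (U : set (borel T)) : open (U : set T) -> measurable U.
Proof. exact: sub_sigma_algebra. Qed.

Lemma borel_closed (C : set (borel T)) : closed (C : set T) -> measurable C.
Proof.
move=> cC; rewrite -[C]setCK; apply: measurableC; apply: borel_open.
exact: closed_openC.
Qed.

Lemma borel_measurable_fun (D : set (borel T)) (phi : T -> R) :
  measurable D -> continuous phi -> measurable_fun D (phi : borel T -> R).
Proof.
move=> mD cphi; apply: measurable_funS (measurableT) _ _ => //.
apply: (measurability _ (RGenOInfty.measurableE R)) => //.
move=> _ [_ [a ->] <-]; rewrite setTI; apply: borel_open.
by apply: open_comp => // x _; exact: cphi.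
Qed.

Lemma borel_integrable (mu : {finite_measure set (borel T) -> \bar R})
    (D : set (borel T)) (phi : T -> R) (M : R) :
  measurable D -> continuous phi -> (forall x, D x -> `|phi x| <= M) ->
  mu.-integrable D (EFin \o phi).
Proof.
move=> mD cphi phiM; apply: measurable_bounded_integrable => //.
- by rewrite ltey_eq fin_num_measure.
- exact: borel_measurable_fun.
- exists M; split; first exact: num_real.
  by move=> N MN x Dx; exact: le_trans (phiM x Dx) (ltW MN).
Qed.

End borel_measures.

(** * Positive functionals on continuous functions *)

Section positive_functionals.
Context {R : realType} {T : topologicalType}.
Implicit Types (L : (T -> R) -> R) (phi psi : T -> R).

(** [L] takes arbitrary functions, but the laws concern continuous ones only; thus integrals and
    limits that may be meaningless elsewhere still qualify. *)
Record positive_functional L : Prop := PositiveFunctional {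
  pf_add : forall phi psi, continuous phi -> continuous psi ->
    L (fun x => phi x + psi x) = L phi + L psi ;
  pf_scale : forall c phi, continuous phi ->
    L (fun x => c * phi x) = c * L phi ;
  pf_ge0 : forall phi, continuous phi -> (forall x, 0 <= phi x) -> 0 <= L phi }.

Context {L : (T -> R) -> R} (posL : positive_functional L).

Lemma pf_sub phi psi : continuous phi -> continuous psi ->
  L (fun x => phi x - psi x) = L phi - L psi.
Proof.
move=> cphi cpsi; rewrite -mulN1r -(pf_scale posL)//.
rewrite -(pf_add posL)//; last by move=> x; apply: cvgM; [exact: cvg_cst|exact: cpsi].
by congr L; apply/funext => x; rewrite mulN1r.
Qed.

Lemma le_pf phi psi : continuous phi -> continuous psi ->
  (forall x, phi x <= psi x) -> L phi <= L psi.
Proof.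
move=> cphi cpsi le_phi; rewrite -subr_ge0 -pf_sub//; apply: (pf_ge0 posL).
  by move=> x; apply: cvgB; [exact: cpsi|exact: cphi].
by move=> x; rewrite subr_ge0.
Qed.

Lemma pf_cst c : L (fun=> c) = c * L (fun=> 1).
Proof.
rewrite -(pf_scale posL); last by move=> x; exact: cvg_cst.
by congr L; apply/funext => x; rewrite mulr1.
Qed.

Lemma pf_norm_le phi M : continuous phi -> (forall x, `|phi x| <= M) ->
  `|L phi| <= M * L (fun=> 1).
Proof.
have cstc (c : R) := @cst_continuous T R c.
move=> cphi phiM; rewrite ler_norml -mulNr -!pf_cst !le_pf// => x.
- by have := phiM x; rewrite ler_norml => /andP[].
- by have := phiM x; rewrite ler_norml => /andP[].
Qed.

(** Continuity of the partial sums is carried through the same induction because additivity is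
    available for continuous functions only. *)
Lemma pf_sum n (g : nat -> T -> R) : (forall i, continuous (g i)) ->
  continuous (fun x => \sum_(i < n) g i x) /\
  L (fun x => \sum_(i < n) g i x) = \sum_(i < n) L (g i).
Proof.
move=> cg; elim: n => [|n [IHc IH]].
  split; last by rewrite big_ord0 -[RHS](mul0r (L (fun=> 1))) -pf_cst;
    congr L; apply/funext => x; rewrite big_ord0.
  by under eq_fun do rewrite big_ord0; move=> x; exact: cvg_cst.
rewrite big_ord_recr /= -IH -(pf_add posL)//; split.
  under eq_fun do rewrite big_ord_recr.
  by move=> x; apply: cvgD; [exact: IHc|exact: cg].
by congr L; apply/funext => x; rewrite big_ord_recr.
Qed.

End positive_functionals.

Lemma Rintegral_positive_functional {R : realType} {T : pmetricType R}
    (mu : {finite_measure set (borel T) -> \bar R}) :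
  compact [set: T] -> positive_functional (fun phi : T -> R => \int[mu]_x phi x).
Proof.
move=> compactT.
have int (phi : T -> R) : continuous phi -> mu.-integrable setT (EFin \o phi).
  move=> cphi; have [M _ phiM] := compact_bound compactT cphi.
  by apply: (@borel_integrable _ _ mu _ _ M) => // x _; exact: phiM.
split.
- by move=> phi psi cphi cpsi; rewrite RintegralD//; exact: int.
- by move=> c phi cphi; rewrite RintegralZl//; exact: int.
- by move=> phi cphi phi0; exact: Rintegral_ge0.
Qed.

(** * The Riesz representation theorem on a compact metric space *)

(* Daniell's construction: the outer measure of A is the infimum of the bounds
   on L over increasing sequences of continuous functions that eventually
   exceed 1 on A. *)
Section riesz.
Context {R : realType} {T : pmetricType R}.
Hypothesis compactT : compact [set: T].
Context {L : (T -> R) -> R} (posL : positive_functional L).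
Implicit Types (A U : set T) (c e : R).

(** The strict inequality makes the sets where [1 < g n x] open, as the compactness argument in
    [covers_setT] and outer regularity require. *)
Let covers c A := exists g : nat -> T -> R,
  [/\ (forall n, continuous (g n)), (forall n x, 0 <= g n x),
      (forall n m x, (n <= m)%N -> g n x <= g m x),
      (forall x, A x -> exists n, 1 < g n x) & (forall n, L (g n) <= c)].

Let cstc (c : R) := @cst_continuous T R c.

Let mulc (phi psi : T -> R) : continuous phi -> continuous psi ->
  continuous (fun x => phi x * psi x).
Proof. by move=> cphi cpsi x; apply: cvgM; [exact: cphi|exact: cpsi]. Qed.

Let subc (phi psi : T -> R) : continuous phi -> continuous psi ->
  continuous (fun x => phi x - psi x).
Proof. by move=> cphi cpsi x; apply: cvgB; [exact: cphi|exact: cpsi]. Qed.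

Let covers_ge0 c A : covers c A -> 0 <= c.
Proof.
by move=> [g [cg g0 _ _ Lg]]; apply: le_trans (Lg 0%N); exact: (pf_ge0 posL).
Qed.

Let covers_sub c A B : A `<=` B -> covers c B -> covers c A.
Proof. by move=> AB [g [cg g0 ndg gB Lg]]; exists g; split => // x /AB/gB. Qed.

(** Diagonal argument: the [n]-th function is the sum, over [i < n], of the [n]-th function of the
    [i]-th cover. It increases with [n] because terms are nonnegative, increase, and only get
    added. *)
Let covers_bigcup (c : nat -> R) (A : nat -> set T) C :
  (forall i, covers (c i) (A i)) -> (forall n, \sum_(i < n) c i <= C) ->
  covers C (\bigcup_i A i).
Proof.
move=> /choice[g gP] cC; have cg i n : continuous (g i n) by have [] := gP i.
have g0 i n x : 0 <= g i n x by have [] := gP i.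
exists (fun n x => \sum_(i < n) g i n x); split.
- by move=> n; have [] := pf_sum posL n (fun i => cg i n).
- by move=> n x; rewrite sumr_ge0.
- move=> n m x nm; apply: (@le_trans _ _ (\sum_(i < n) g i m x)).
    by apply: ler_sum => i _; have [_ _ ndg _ _] := gP i; exact: ndg.
  rewrite -(big_mkord xpredT (fun i => g i m x)).
  rewrite -(big_mkord xpredT (fun i => g i m x)).
  by rewrite (big_cat_nat (leq0n n) nm)/= lerDl sumr_ge0.
- move=> x [i _ Aix]; have [_ _ ndg gA _] := gP i; have [n gn] := gA x Aix.
  exists (maxn i.+1 n); rewrite (bigD1 (Ordinal (leq_maxl i.+1 n)))//=.
  by rewrite ltr_wpDr ?sumr_ge0// (lt_le_trans gn)// ndg// leq_maxr.
- move=> n; have [_ ->] := pf_sum posL n (fun i => cg i n).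
  apply: le_trans (cC n); apply: ler_sum => i _.
  by have [_ _ _ _ Lg] := gP i; exact: Lg.
Qed.

(** A constant sequence suffices; the factor [1 + e] pays for the strict inequality in [covers]. *)
Let covers_fun A (psi : T -> R) e : continuous psi -> (forall x, 0 <= psi x) ->
  (forall x, A x -> 1 <= psi x) -> 0 < e -> covers ((1 + e) * L psi) A.
Proof.
move=> cpsi psi0 psi1 e0.
have c1 : continuous (fun x => (1 + e) * psi x) by apply: mulc.
exists (fun _ x => (1 + e) * psi x); split => //.
- by move=> _ x; rewrite mulr_ge0// addr_ge0// ltW.
- by move=> x /psi1 px; exists 0%N; nra.
- by move=> _; rewrite (pf_scale posL).
Qed.

(* With u_n increasing to the indicator of U and g_n covering A, the g_n u_n
   cover A `&` U, and the g_n (1 - u_k) cover A `\` U at a cost close to what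
   remains once L (g_k u_k) is almost maximal. *)
Let covers_split c A U e : covers c A -> open U -> 0 < e -> exists a b,
  [/\ covers a (A `&` U), covers b (A `&` ~` U) & a + b <= c + e].
Proof.
move=> [g [cg g0 ndg gA Lg]] oU e0.
have [u [lipu u01 ndu uU0 uU1]] := lip_open_approx oU.
have cu n : continuous (u n) by exact: lip_continuous (lipu n).
have u0 n x : 0 <= u n x by have /andP[] := u01 n x.
have u1 n x : 0 <= 1 - u n x by have := u01 n x; lra.
pose p n x := g n x * u n x.
have cp n : continuous (p n) by exact: mulc.
have ndp n m x : (n <= m)%N -> p n x <= p m x.
  by move=> nm; rewrite /p ler_pM// ?ndg ?ndu.
have le_pg n : L (p n) <= c.
  apply: le_trans (Lg n); apply: le_pf => // x; rewrite /p ler_piMr//.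
  by have /andP[] := u01 n x.
pose S := [set L (p n) | n in [set: nat]].
have Sub : has_ubound S by exists c => _ [n _ <-].
have S0 : S !=set0 by exists (L (p 0%N)), 0%N.
(* [L (p k)] is within [e] of the supremum. The budget [c + e] is then shared: [sup S] for the part
   in [U], the rest for the part outside. *)
have [_ [k _ <-] Sk] := sup_adherent e0 (conj S0 Sub).
exists (sup S), (c + e - sup S); split; last lra.
  exists p; split => //.
  - by move=> n x; rewrite mulr_ge0.
  - move=> x [Ax Ux]; have [n gn] := gA x Ax; have [N uN] := uU1 x Ux.
    exists (maxn n N); rewrite /p uN ?leq_maxr// mulr1 (lt_le_trans gn)//.
    by rewrite ndg// leq_maxl.
  - by move=> n; apply: ub_le_sup => //; exists n.
pose q n x := g n x * (1 - u k x).
have cq n : continuous (q n) by apply: mulc => //; exact: subc.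
have ndq n m x : (n <= m)%N -> q n x <= q m x.
  by move=> nm; rewrite /q ler_wpM2r// ndg.
exists q; split => //.
- by move=> n x; rewrite mulr_ge0.
- move=> x [Ax nUx]; have [n gn] := gA x Ax; exists n.
  by rewrite /q uU0// subr0 mulr1.
(* At an index beyond [k], the product of [g] and [u k] dominates [p k], so the cost is at most
   [c - L (p k)]. *)
- move=> n; apply: (@le_trans _ _ (L (q (maxn n k)))).
    by apply: le_pf => // x; apply: ndq; rewrite leq_maxl.
  have -> : q (maxn n k) =
      (fun x => g (maxn n k) x - g (maxn n k) x * u k x).
    by apply/funext => x; rewrite /q mulrBr mulr1.
  have cgu : continuous (fun x => g (maxn n k) x * u k x) by exact: mulc.
  rewrite pf_sub//; have : L (p k) <= L (fun x => g (maxn n k) x * u k x).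
    by apply: le_pf => // x; rewrite /p ler_wpM2r// ndg// leq_maxr.
  by have := Lg (maxn n k); lra.
Qed.

(** Dini's argument: the open sets where [1 < g n] increase and cover a compact space, so a single
    [g n] exceeds 1 everywhere. *)
Let covers_setT c : covers c setT -> L (fun=> 1) <= c.
Proof.
move=> [g [cg g0 ndg gT Lg]].
have : \forall n \near \oo, forall x, [set: T] x -> 1 < g n x.
  move/compact_near_coveringP : compactT; apply => x _.
  have [n gn] := gT x I; exists ([set y | 1 < g n y], [set m | (n <= m)%N]).
    by split; [exact: (cvgr_gt (g n x) (cg n x))|exists n].
  by move=> [y m] /= [gny nm]; exact: lt_le_trans gny (ndg _ _ _ nm).
move=> [n _ /(_ n (leqnn _)) gn]; apply: le_trans (Lg n).
by apply: le_pf => // x; rewrite ltW// gn.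
Qed.

Let outer A : \bar R := ereal_inf [set c%:E | c in [set c | covers c A]].

Let outer_le c A : covers c A -> (outer A <= c%:E)%E.
Proof. by move=> cA; apply: ereal_inf_lbound; exists c. Qed.

Let outer_lt A (x : \bar R) : (outer A < x)%E ->
  exists2 c, covers c A & (c%:E < x)%E.
Proof. by move=> /ereal_inf_lt[_ [c cA <-] cx]; exists c. Qed.

Let outer_ge0 A : (0 <= outer A)%E.
Proof. by apply: le_ereal_inf_tmp => _ [c /covers_ge0 c0 <-]; rewrite lee_fin. Qed.

Let outer_fun A (psi : T -> R) : continuous psi -> (forall x, 0 <= psi x) ->
  (forall x, A x -> 1 <= psi x) -> (outer A <= (L psi)%:E)%E.
Proof.
move=> cpsi psi0 psi1; apply/lee_addgt0Pr => e e0.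
have L0 : 0 <= L psi by exact: (pf_ge0 posL).
have L1 : 0 < L psi + 1 by rewrite ltr_wpDl.
have d0 : 0 < e / (L psi + 1) by rewrite divr_gt0.
apply: le_trans (outer_le (covers_fun cpsi psi0 psi1 d0)) _.
rewrite -EFinD lee_fin mulrDl mul1r lerD2l mulrAC ler_pdivrMr//.
by rewrite ler_pM2l// lerDl.
Qed.

Let outer_fin A : outer A \is a fin_num.
Proof.
rewrite ge0_fin_numE//; apply: (@le_lt_trans _ _ (L (fun=> 1))%:E); last exact: ltry.
by apply: outer_fun => // x _; exact: ler01.
Qed.

Let outer0 : outer set0 = 0%E.
Proof.
apply/eqP; rewrite eq_le outer_ge0 andbT.
have -> : 0%E = (L (fun=> 0))%:E by rewrite (pf_cst posL) mul0r.
by apply: outer_fun.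
Qed.

(** Near-optimal covers of the [F i], with errors [e / 2 ^ i.+1] that add up to [e], are merged by
    [covers_bigcup]. *)
Let outer_subadditive A F : subset_sigma_subadditive outer A F.
Proof.
move=> AF; apply/lee_addgt0Pr => e e0.
apply: le_trans (epsilon_trick xpredT _ (ltW e0)); last by [].
have /choice[c cP] : forall i, exists c, covers c (F i) /\
    (c%:E <= outer (F i) + (e / (2 ^ i.+1)%:R)%:E)%E.
  move=> i; have [|c cF cx] := @outer_lt (F i) (outer (F i) + (e / (2 ^ i.+1)%:R)%:E)%E.
    by rewrite lteDl// lte_fin divr_gt0.
  by exists c; split => //; exact: ltW.
set S := (X in (_ <= X)%E).
have term_ge0 i : (0 <= outer (F i) + (e / (2 ^ i.+1)%:R)%:E)%E.
  by rewrite adde_ge0// lee_fin divr_ge0// ltW.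
(* An infinite sum leaves nothing to prove; a finite one is a real bound to which [covers]
   applies. *)
have [->|Soo] := eqVneq S +oo%E; first exact: leey.
have Sfin : S \is a fin_num.
  rewrite ge0_fin_numE; last by apply: nneseries_ge0.
  by rewrite ltey.
rewrite -(fineK Sfin); apply: outer_le.
apply: covers_sub AF _; apply: covers_bigcup (fun i => (cP i).1) _ => n.
rewrite -lee_fin fineK// -sumEFin.
apply: (@le_trans _ _ (\sum_(i < n) (outer (F i) + (e / (2 ^ i.+1)%:R)%:E))%E).
  by apply: lee_sum => i _; exact: (cP i).2.
rewrite -(big_mkord xpredT (fun i => outer (F i) + (e / (2 ^ i.+1)%:R)%:E)%E).
exact: nneseries_lim_ge.
Qed.

Let outer_isOuter := isSubsetOuterMeasure.Build R T outer
  outer0 outer_ge0 outer_subadditive.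
Let outerm : {outer_measure set T -> \bar R} := HB.pack outer outer_isOuter.

(** The Caratheodory-measurable sets form a sigma-algebra, so open sets suffice. For these, half of
    [e] goes into the choice of a cover and half into [covers_split]. *)
Let outer_caratheodory (A : set (borel T)) : measurable A ->
  (outerm.-caratheodory) A.
Proof.
have sC := @sigma_algebra_measurable _ (caratheodory_type outerm).
move: A; apply: smallest_sub => // U oU.
apply: le_caratheodory_measurable => A; apply/lee_addgt0Pr => e e0.
have e20 : 0 < e / 2 by rewrite divr_gt0.
have [|c cA cx] := @outer_lt A (outer A + (e / 2)%:E)%E.
  by rewrite lteDl ?lte_fin.
have [a [b [aA bA abc]]] := covers_split cA oU e20.
apply: (@le_trans _ _ (a%:E + b%:E)%E); first exact: leeD (outer_le _) (outer_le _).
apply: (@le_trans _ _ (c%:E + (e / 2)%:E)%E); first by rewrite -!EFinD lee_fin.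
rewrite [in leRHS](splitr e) EFinD addeA leeD2r//; exact: ltW.
Qed.

Let rm (A : set (borel T)) : \bar R := outer A.

Let rm_sigma_additive : semi_sigma_additive rm.
Proof.
move=> F mF tF mUF; apply: (caratheodory_measure_sigma_additive (mu := outerm)) => //.
- by move=> i; exact: outer_caratheodory.
- exact: outer_caratheodory.
Qed.

Let rm_isMeasure := isMeasure.Build _ _ _ rm outer0 outer_ge0 rm_sigma_additive.
Let rmm : {measure set (borel T) -> \bar R} := HB.pack rm rm_isMeasure.

Let rm_fin : fin_num_fun rmm.
Proof. by move=> A _; exact: outer_fin. Qed.

Let rm_isFinite := Measure_isFinite.Build _ _ _ rmm rm_fin.
Let riesz_measure : {finite_measure set (borel T) -> \bar R} :=
  HB.pack rm rm_isMeasure rm_isFinite.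

Let minc (phi : T -> R) c : continuous phi ->
  continuous (fun x => Num.min (phi x) c).
Proof. by move=> cphi x; apply: continuous_min; [exact: cphi|exact: cvg_cst]. Qed.

Let fine_rm_ge0 A : 0 <= fine (riesz_measure A).
Proof. by apply: fine_ge0; exact: outer_ge0. Qed.

(* The layers of phi between two multiples of d are compared with the level
   set between them, which L bounds through the preceding layer. *)
Let Rintegral_layers (phi : T -> R) d k : continuous phi ->
    (forall x, 0 <= phi x) -> 0 < d ->
  \int[riesz_measure]_x Num.min (phi x) (k.+1%:R * d) <=
  d * fine (riesz_measure setT) + L (fun x => Num.min (phi x) (k%:R * d)).
Proof.
move=> cphi phi0 d0.
have posI := Rintegral_positive_functional riesz_measure compactT.
elim: k => [|k IH].
  (* Base case: the first layer is at most [d], and truncation at height 0 leaves a nonnegative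
     function. *)
  rewrite -[leLHS]addr0 lerD//; last first.
    apply: (pf_ge0 posL); first exact: minc.
    by move=> x; rewrite mul0r le_min phi0 lexx.
  rewrite -(Rintegral_cst riesz_measure measurableT).
  apply: (le_pf posI); [exact: minc|exact: cst_continuous|].
  by move=> x; rewrite mul1r ge_min lexx orbT.
(* [c] is the layer of [phi] above height [k.+1%:R * d] and vanishes off [A]; [psi] is the layer
   just below, divided by [d] so that it is 1 on [A]. *)
set c := fun x => Num.min (phi x) (k.+2%:R * d) - Num.min (phi x) (k.+1%:R * d).
set psi := fun x => d^-1 *
  (Num.min (phi x) (k.+1%:R * d) - Num.min (phi x) (k%:R * d)).
pose A : set (borel T) := [set x : T | k.+1%:R * d < phi x].
have kd1 : k.+1%:R * d = k%:R * d + d by rewrite -addn1 natrD; ring.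
have kd2 : k.+2%:R * d = k%:R * d + d + d by rewrite -addn2 natrD; ring.
have mA : measurable A.
  apply: borel_open; have -> : A = phi @^-1` [set y | k.+1%:R * d < y] by [].
  by apply: open_comp => [x _|]; [exact: cphi|exact: open_gt].
have cc : continuous c by apply: subc; exact: minc.
have cpsi : continuous psi by apply: mulc => //; apply: subc; exact: minc.
have c01 x : 0 <= c x <= d.
  rewrite /c kd1 kd2 /Num.min; case: ltrP => a; case: ltrP => b; lra.
have cA x : ~ A x -> c x = 0.
  move=> /negP; rewrite -leNgt => Ax; rewrite /c !min_l ?subrr//.
  by move: Ax; rewrite kd1 kd2; lra.
have psi0 x : 0 <= psi x.
  rewrite mulr_ge0 ?invr_ge0 ?(ltW d0)// kd1 /Num.min.
  by case: ltrP => a; case: ltrP => b; lra.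
have psiA x : A x -> 1 <= psi x.
  rewrite /A /= kd1 => Ax; rewrite /psi !min_r; try lra.
  by rewrite kd1 addrAC subrr add0r mulVf ?gt_eqF.
have le_A : \int[riesz_measure]_x c x <= d * fine (riesz_measure A).
  have -> : \int[riesz_measure]_x c x = \int[riesz_measure]_(x in A) c x.
    rewrite [RHS]Rintegral_mkcond; apply: eq_Rintegral => x _.
    by rewrite patchE; case: ifPn => // /negP; rewrite inE => /cA.
  have intA (f : T -> R) : continuous f -> (forall x, 0 <= f x <= d) ->
      riesz_measure.-integrable A (EFin \o f).
    move=> cf f01; apply: (@borel_integrable _ _ riesz_measure _ _ d) => // x _.
    by have /andP[f0 f1] := f01 x; rewrite ger0_norm.
  rewrite -Rintegral_cst//; apply: le_Rintegral => //.
  - exact: intA.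
  - by apply: (intA (fun=> d)) => // x; rewrite lexx ltW.
  - by move=> x _; have /andP[] := c01 x.
have A_psi : fine (riesz_measure A) <= L psi.
  by rewrite -lee_fin fineK ?outer_fin//; exact: outer_fun.
have -> : (fun x => Num.min (phi x) (k.+2%:R * d)) =
    (fun x => Num.min (phi x) (k.+1%:R * d) + c x).
  by apply/funext => x; rewrite /c addrC subrK.
rewrite (pf_add posI) //; last exact: minc.
have := pf_scale posL d cpsi.
have -> : (fun x => d * psi x) =
    (fun x => Num.min (phi x) (k.+1%:R * d) - Num.min (phi x) (k%:R * d)).
  by apply/funext => x; rewrite /psi mulVKf ?gt_eqF.
rewrite (pf_sub posL); [|exact: minc|exact: minc].
(* The integral of [c] is thus at most [L] of the preceding layer, which telescopes with the
   induction hypothesis. *)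
have : d * fine (riesz_measure A) <= d * L psi by rewrite ler_pM2l.
by move: le_A IH; lra.
Qed.

(** When [N%:R * d] is above the bound of [phi], the truncations in [Rintegral_layers] have no
    effect; [d] is small enough that [d] times the total mass is at most [e]. *)
Let Rintegral_le (phi : T -> R) : continuous phi -> (forall x, 0 <= phi x) ->
  \int[riesz_measure]_x phi x <= L phi.
Proof.
move=> cphi phi0; apply/ler_addgt0Pr => e e0.
set m := fine (riesz_measure setT).
have m1 : 0 < m + 1 by rewrite ltr_wpDl // fine_rm_ge0.
pose d := e / (m + 1); have d0 : 0 < d by rewrite divr_gt0.
have [M M0 phiM] := compact_bound compactT cphi.
pose N := (Num.truncn (M / d)).+1.
have MN : M <= N%:R * d by rewrite -ler_pdivrMr// ltW// truncnS_gt.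
have minN k : (N <= k)%N -> (fun x => Num.min (phi x) (k%:R * d)) = phi.
  move=> Nk; apply/funext => x; apply/min_idPl.
  rewrite (le_trans (ler_norm _))// (le_trans (phiM x))// (le_trans MN)//.
  by rewrite ler_pM2r// ler_nat.
have := Rintegral_layers N cphi phi0 d0; rewrite !minN// -/m.
move=> /le_trans; apply; rewrite addrC lerD2l /d mulrAC ler_pdivrMr//.
by rewrite ler_pM2l// lerDl.
Qed.

Let riesz_setT : fine (riesz_measure setT) = L (fun=> 1).
Proof.
apply/eqP; rewrite eq_le -!lee_fin fineK ?outer_fin//; apply/andP; split.
  by apply: outer_fun => // x _; exact: ler01.
apply/lee_addgt0Pr => e e0.
have [|c cT cx] := @outer_lt setT (outer setT + e%:E)%E.
  by rewrite lteDl ?lte_fin.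
by apply: le_trans (ltW cx); rewrite lee_fin; exact: covers_setT.
Qed.

(** [Rintegral_le] for [phi + M] and for [M - phi] gives the two inequalities, since the constants
    integrate correctly by [riesz_setT]. *)
Let riesz_Rintegral (phi : T -> R) : continuous phi ->
  \int[riesz_measure]_x phi x = L phi.
Proof.
move=> cphi; have [M M0 phiM] := compact_bound compactT cphi.
have posI := Rintegral_positive_functional riesz_measure compactT.
have I1 : \int[riesz_measure]_x 1 = L (fun=> 1).
  by rewrite Rintegral_cst// mul1r riesz_setT.
have cD : continuous (fun x => phi x + M).
  by move=> x; apply: cvgD; [exact: cphi|exact: cst_continuous].
have := Rintegral_le cD; rewrite (pf_add posL)// (pf_add posI)//.
have cB : continuous (fun x => M - phi x) by exact: subc.
have := Rintegral_le cB; rewrite (pf_sub posL)// (pf_sub posI)//.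
rewrite (pf_cst posL M) (pf_cst posI M) I1 => IB ID.
have phiMx x : - M <= phi x <= M by rewrite -ler_norml.
apply/eqP; rewrite eq_le; apply/andP; split.
- by have := ID (fun x => ltac:(have := phiMx x; lra)); lra.
- by have := IB (fun x => ltac:(have := phiMx x; lra)); lra.
Qed.

(** The union of the open sets where [1 < g n x] is covered by the same sequence [g] at the same
    cost as [A]. *)
Let outer_regular A e : 0 < e -> exists U,
  [/\ open U, A `<=` U & (outer U <= outer A + e%:E)%E].
Proof.
move=> e0; have [|c [g [cg g0 ndg gA Lg]] cx] := @outer_lt A (outer A + e%:E)%E.
  by rewrite lteDl ?lte_fin.
exists (\bigcup_n [set x | 1 < g n x]); split.
- apply: bigcup_open => n _; apply: (open_comp (f := g n) (D := [set y | 1 < y])).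
    by move=> x _; exact: cg.
  exact: open_gt.
- by move=> x /gA[n gn]; exists n.
- apply: le_trans (ltW cx); apply: outer_le; exists g; split => //.
  by move=> x [n _ gn]; exists n.
Qed.

Let riesz_regular : regular_measure riesz_measure.
Proof.
have le_outer (A B : set T) : A `<=` B -> (outer A <= outer B)%E.
  exact: (le_outer_measure outerm).
move=> A mA; split; apply/eqP; rewrite eq_le; apply/andP; split.
- by apply: le_ereal_inf_tmp => _ [U [_ AU] <-]; exact: le_outer.
- apply/lee_addgt0Pr => e e0; have [U [oU AU Ue]] := outer_regular A e0.
  by apply: le_trans Ue; apply: ereal_inf_lbound; exists U.
(* Inner regularity by complements: an open set slightly larger than the complement of [A] has a
   compact complement inside [A], and the total mass is finite. *)
- apply/lee_addgt0Pr => e e0; have [U [oU AU Ue]] := outer_regular (~` A) e0.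
  have mU : measurable (U : set (borel T)) by exact: borel_open.
  have KA : ~` U `<=` A by move=> x nUx; apply: contrapT => /AU.
  have kK : compact (~` U).
    by apply: subclosed_compact compactT _ => //; exact: open_closedC.
  apply: (@le_trans _ _ (outer (~` U) + e%:E)%E); last first.
    by rewrite leeD2r//; apply: ereal_sup_ubound; exists (~` U).
  have split_T (B : set (borel T)) : measurable B ->
      fine (outer setT) = fine (outer B) + fine (outer (~` B)).
    move=> mB; rewrite -fineD ?outer_fin//; congr fine.
    have := @measureU _ _ _ riesz_measure B (~` B) mB (measurableC mB).
    by rewrite setUv setICr => /(_ erefl).
  have Ufe : fine (outer U) <= fine (outer (~` A)) + e.
    by rewrite -lee_fin EFinD !fineK ?outer_fin.
  suff : fine (outer A) <= fine (outer (~` U)) + e.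
    by rewrite -lee_fin EFinD !fineK ?outer_fin.
  by have := split_T _ mA; have := split_T _ mU; move: Ufe; lra.
- by apply: ge_ereal_sup => _ [K [_ KA] <-]; exact: le_outer.
Qed.

Theorem riesz_representation :
  exists mu : {finite_measure set (borel T) -> \bar R},
  regular_measure mu /\
  forall phi : T -> R, continuous phi -> \int[mu]_x phi x = L phi.
Proof. by exists riesz_measure. Qed.

End riesz.

(** * Measures tested against Lipschitz functions *)

Section lipschitz_test_functions.
Context {R : realType} {T : pmetricType R}.
Implicit Types mu nu : {finite_measure set (borel T) -> \bar R}.

(** Monotone convergence to the indicator of [U]. The sequence is chosen before [mu], so that one
    sequence can serve two measures. *)
Lemma open_measure_lip_cvg (U : set T) : open U -> exists u : nat -> T -> R,
  [/\ (forall n, lip n%:R (u n)), (forall n x, ~ U x -> u n x = 0) &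
      forall mu, (\int[mu]_x u n x)%:E @[n --> \oo] --> mu U].
Proof.
move=> oU; have [u [lipu u01 ndu uU0 uU1]] := lip_open_approx oU.
exists u; split => // mu.
have cu n : continuous (u n) by exact: lip_continuous (lipu n).
have u0 n x : 0 <= u n x by have /andP[] := u01 n x.
have -> : mu U = (\int[mu]_x limn (fun n => (u n x)%:E))%E.
  rewrite -[U in LHS]setIT -integral_indic//; last exact: borel_open.
  apply: eq_integral => x _; apply/esym/cvg_lim => //.
  have [Ux|nUx] := pselect (U x).
    have [N uN] := uU1 x Ux; rewrite indicE mem_set//.
    by apply: cvg_near_cst; exists N => // n /= Nn; rewrite uN.
  rewrite indicE memNset//; apply: cvg_near_cst.
  by exists 0%N => // n _; rewrite uU0.
have -> : (fun n => (\int[mu]_x u n x)%:E) = (fun n => \int[mu]_x (u n x)%:E)%E.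
  apply/funext => n; rewrite /Rintegral fineK//; apply: integrable_fin_num => //.
  apply: (@borel_integrable _ _ mu _ _ 1) => // x _.
  by rewrite ger0_norm//; have /andP[] := u01 n x.
apply: cvg_monotone_convergence => //.
- by move=> n; apply/measurable_EFinP; exact: borel_measurable_fun.
- by move=> n x _; rewrite lee_fin.
- by move=> x _ n m nm; rewrite lee_fin ndu.
Qed.

(** Open sets are stable under intersection and generate the Borel sets, so it suffices to recover
    the measures of open sets from Lipschitz integrals. *)
Lemma lip_measure_unique mu nu :
    (forall K phi, 0 <= K -> lip K phi -> \int[mu]_x phi x = \int[nu]_x phi x) ->
  forall A, measurable A -> mu A = nu A.
Proof.
move=> mu_nu A; apply: (@measure_unique _ _ (borel T) (@open T) (fun=> setT)) => //.
- exact: openI.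
- by move=> _; exact: openT.
- by rewrite bigcup_const.
- move=> U oU; have [u [lipu _ cvgu]] := open_measure_lip_cvg oU.
  have := cvgu nu; under eq_fun do rewrite -(mu_nu _ _ (ler0n _ _) (lipu _)).
  by move=> cvgnu; exact: cvg_unique (cvgu mu) cvgnu.
- by move=> _; rewrite ltey_eq fin_num_measure.
Qed.

(** The Lipschitz functions that increase to the indicator of the complement of [W] all vanish on
    [W]. *)
Lemma measure0_lip_test mu (W : set T) : closed W ->
    (forall K phi, 0 <= K -> lip K phi -> (forall x, W x -> phi x = 0) ->
      \int[mu]_x phi x = 0) ->
  mu (~` W) = 0%E.
Proof.
move=> cW muW; have [u [lipu uW cvgu]] := open_measure_lip_cvg (closed_openC cW).
apply: (cvg_unique _ (cvgu mu)) => //.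
have -> : (fun n => (\int[mu]_x u n x)%:E) = fun=> 0%E.
  apply/funext => n; rewrite (muW n%:R)// => x Wx.
  by apply: uW => nWx; exact: nWx.
exact: cvg_cst.
Qed.

End lipschitz_test_functions.

(** * The compact-open topology on continuous maps *)

Section cspace_topology.
Context {R : realType} {Y X : topologicalType}.
Implicit Types (f g : cspace Y X) (phi : X -> R).

Lemma cspace_continuous f : continuous f.
Proof. by case: f => f [[]]. Qed.

Lemma cspace_open (K : set Y) (O : set X) :
  compact K -> open O -> open [set f : cspace Y X | f @` K `<=` O].
Proof.
move=> kK oO; exists [set g : {compact-open, Y -> X} | g @` K `<=` O] => //.
exact: compact_open_open.
Qed.

(** Singletons are compact, so neighbourhoods of the values at a point [x] give neighbourhoods of
    the maps. This makes compact families closed, hence Borel. *)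
Lemma cspace_hausdorff : hausdorff_space X -> hausdorff_space (cspace Y X).
Proof.
move=> hX f g fg; apply/continuousEP => x; apply: hX => A B.
rewrite !nbhsE => -[A' [oA' A'f] A'A] [B' [oB' B'g] B'B].
pose ev (O : set X) := [set h : cspace Y X | h @` [set x] `<=` O].
have ev_nbhs O (h : cspace Y X) : open O -> O (h x) -> nbhs h (ev O).
  move=> oO Oh; apply: open_nbhs_nbhs; split; last by move=> _ [_ -> <-].
  by apply: cspace_open => //; exact: compact_set1.
have [h [hA hB]] := fg _ _ (ev_nbhs A' f oA' A'f) (ev_nbhs B' g oB' B'g).
by exists (h x); split; [apply/A'A/hA|apply/B'B/hB]; exists x.
Qed.

Hypothesis compactY : compact [set: Y].

Lemma comp_cspace_continuous f phi :
  continuous phi -> continuous (fun y => phi (f y)).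
Proof.
move=> cphi y; apply: (@continuous_comp _ _ _ f phi); last exact: cphi.
exact: cspace_continuous.
Qed.

(** Around [y], take a compact neighbourhood [K] on which [phi] after [f] moves by at most [e / 4],
    and ask [g] to send [K] where [phi] is within [e / 2] of [phi (f y)]. Compactness of [Y] makes
    these local conditions uniform. *)
Lemma cspace_uniform_near phi f (e : R) : continuous phi -> 0 < e ->
  nbhs f [set g : cspace Y X | forall y, `|phi (f y) - phi (g y)| <= e].
Proof.
move=> cphi e0.
suff : nbhs f [set g : cspace Y X |
    forall y, [set: Y] y -> `|phi (f y) - phi (g y)| <= e].
  by apply: filterS => g fg y; exact: fg.
have /compact_near_coveringP nc := compactY.
apply: (nc _ (nbhs f) (fun (g : cspace Y X) y => `|phi (f y) - phi (g y)| <= e)).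
move=> y _.
have cpf : continuous (fun z => phi (f z)) by exact: comp_cspace_continuous.
pose K := [set z | `|phi (f y) - phi (f z)| <= e / 4].
have cdist (S : topologicalType) (psi : S -> R) (c : R) :
    continuous psi -> continuous (fun z => `|c - psi z|).
  by move=> cpsi z; apply: cvg_norm; apply: cvgB; [exact: cvg_cst|exact: cpsi].
have kK : compact K.
  apply: subclosed_compact compactY _ => //.
  apply: (@closed_comp _ _ (fun z => `|phi (f y) - phi (f z)|)
    [set c | c <= e / 4]) => [z _|]; last exact: closed_le.
  exact: (cdist _ _ _ cpf).
pose O := [set x | `|phi (f y) - phi x| < e / 2].
have oO : open O.
  apply: (@open_comp _ _ (fun x => `|phi (f y) - phi x|) [set c | c < e / 2])
    => [x _|]; last exact: open_lt.
  exact: (cdist _ _ _ cphi).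
have nK : nbhs y K by have /cvgrPdist_le := cpf y; apply; rewrite divr_gt0.
exists (K, [set g : cspace Y X | g @` K `<=` O]).
  split => //; apply: open_nbhs_nbhs; split; first exact: cspace_open.
  by move=> _ [z Kz <-]; move: Kz; rewrite /K /O /=; lra.
move=> [z g] /= [Kz gK]; have : O (g z) by apply: gK; exists z.
by move: Kz; rewrite /K /O /= !ler_norml !ltr_norml; lra.
Qed.

(** Follows from [cspace_uniform_near] and boundedness of [L]. It makes the integrands of [transfer]
    Borel functions of [f]. *)
Lemma pf_comp_continuous (L : (Y -> R) -> R) phi : positive_functional L ->
  continuous phi -> continuous (fun f : cspace Y X => L (fun y => phi (f y))).
Proof.
move=> posL cphi f.
apply/(@cvgrPdist_le _ _ _ (nbhs f) (nbhs_filter f)) => e e0.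
have L0 : 0 <= L (fun=> 1).
  by apply: (pf_ge0 posL) => [x|x]; [exact: cvg_cst|exact: ler01].
have L1 : 0 < L (fun=> 1) + 1 by rewrite ltr_wpDl.
have d0 : 0 < e / (L (fun=> 1) + 1) by rewrite divr_gt0.
apply: (@filterS _ (nbhs f) (nbhs_filter f) _ _ _
  (cspace_uniform_near f cphi d0)) => g fg.
rewrite -(pf_sub posL); [|exact: comp_cspace_continuous..].
apply: le_trans (pf_norm_le posL _ fg) _.
  by move=> y; apply: cvgB; exact: comp_cspace_continuous.
by rewrite mulrAC ler_pdivrMr// ler_pM2l// lerDl.
Qed.

Lemma pf_comp_le (L : (Y -> R) -> R) phi f M : positive_functional L ->
  continuous phi -> (forall x, `|phi x| <= M) ->
  `|L (fun y => phi (f y))| <= M * L (fun=> 1).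
Proof.
move=> posL cphi phiM; apply: (pf_norm_le posL) => //.
exact: comp_cspace_continuous.
Qed.

End cspace_topology.

(** The right-hand side tends to 0. This turns estimates valid for all iterates into equalities. *)
Lemma geometric_le0 {R : realType} (r a b : R) :
  0 <= r < 1 -> (forall k, a <= r ^+ k * b) -> a <= 0.
Proof.
move=> /andP[r0 r1] arb.
have cvgb : (fun k => r ^+ k * b) @ \oo --> 0.
  rewrite -[X in _ --> X](mul0r b); apply: cvgMl; apply: cvg_expr.
  by rewrite ger0_norm.
rewrite -(cvg_lim _ cvgb)//; apply: limr_ge; first by apply/cvg_ex; exists 0.
by apply: nearW => k; exact: arb.
Qed.

(** * The contracting operator on tuples of functionals and its fixed point *)

Section transfer_operator.
Context {R : realType} {n : nat} {X : 'I_n -> pmetricType R}.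
Hypothesis X_compact : forall i, compact [set: X i].
Arguments X_compact : clear implicits.
Context (F : forall i j : 'I_n, set (cspace (X j) (X i))).
Arguments F : clear implicits.
Hypothesis F_compact : forall i j, compact (F i j).
Arguments F_compact : clear implicits.
Context {r : R} (r01 : 0 <= r < 1).
Hypothesis F_contraction : forall i j f, F i j f ->
  forall x y, mdist (f x) (f y) <= r * mdist x y.
Context (sigma : forall i j : 'I_n,
  {finite_measure set (borel (cspace (X j) (X i))) -> \bar R}).
Context (m : 'I_n -> R) (m_gt0 : forall i, 0 < m i).
Hypothesis m_eigen :
  forall i, \sum_(j < n) fine (sigma i j (F i j)) * m j = m i.

Definition functionals := forall i, (X i -> R) -> R.
Implicit Types L : functionals.

(** This is the right-hand side of the invariance equation, with [L j] in place of integration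
    against the [j]-th measure. *)
Definition transfer L : functionals := fun i phi =>
  \sum_(j < n) \int[sigma i j]_(f in F i j) L j (fun y => phi (f y)).

Arguments transfer : clear implicits.

Definition positive L := forall i, positive_functional (L i).

Definition normalized L := positive L /\ forall i, L i (fun=> 1) = m i.

(* The Lipschitz constants of test functions are weighted by the masses, so
   that the eigenvector equation makes [transfer] contract with factor r. *)
Definition close (c : R) L L' := forall i K phi, 0 <= K -> lip K phi ->
  `|L i phi - L' i phi| <= c * K * m i.

Let r_ge0 : 0 <= r. Proof. by have /andP[] := r01. Qed.

Lemma measurable_family i j : measurable (F i j : set (borel (cspace (X j) (X i)))).
Proof.
apply: borel_closed; apply: compact_closed (F_compact i j).
exact: cspace_hausdorff (@metric_hausdorff _ _).
Qed.
Arguments measurable_family : clear implicits.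
Hint Resolve measurable_family : core.

Lemma integrable_family L i j (phi : X i -> R) :
  positive L -> continuous phi ->
  (sigma i j).-integrable (F i j)
    (EFin \o (fun f : cspace (X j) (X i) => L j (fun y => phi (f y)))).
Proof.
move=> posL cphi; have [M _ phiM] := compact_bound (X_compact i) cphi.
apply: (@borel_integrable _ _ (sigma i j) (F i j)
  (fun f => L j (fun y => phi (f y))) (M * L j (fun=> 1))) => //.
- exact: pf_comp_continuous (X_compact j) _ _ (posL j) cphi.
- by move=> f _; exact: pf_comp_le (posL j) cphi phiM.
Qed.

Arguments integrable_family [L i] j [phi].

Lemma transfer_positive L : positive L -> positive (transfer L).
Proof.
move=> posL i; split.
- move=> phi psi cphi cpsi; rewrite /transfer -big_split; apply: eq_bigr => j _.
  rewrite /= -(RintegralD (measurable_family i j) (integrable_family j posL cphi)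
    (integrable_family j posL cpsi)).
  by apply: eq_Rintegral => f _; rewrite (pf_add (posL j))//;
    exact: comp_cspace_continuous.
- move=> c phi cphi; rewrite /transfer mulr_sumr; apply: eq_bigr => j _.
  rewrite -(RintegralZl _ (measurable_family i j) (integrable_family j posL cphi)).
  by apply: eq_Rintegral => f _; rewrite (pf_scale (posL j))//;
    exact: comp_cspace_continuous.
- move=> phi cphi phi0; rewrite /transfer; apply: sumr_ge0 => j _.
  apply: Rintegral_ge0 => f _; apply: (pf_ge0 (posL j)) => //.
  exact: comp_cspace_continuous.
Qed.

(** On constants, conservation of the masses is the eigenvector equation. *)
Lemma transfer_normalized L : normalized L -> normalized (transfer L).
Proof.
move=> [posL L1]; split; first exact: transfer_positive.
move=> i; rewrite /transfer -[RHS]m_eigen; apply: eq_bigr => j _.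
by rewrite L1 (Rintegral_cst _ (measurable_family i j)) mulrC.
Qed.

(** Integrating the bound over [F i j] multiplies it by the mass of [F i j], and the eigenvector
    equation sums the results to [c * m i]. Only positivity is asked of the tuples, so that the zero
    tuple is allowed in [transfer_fixed_vanish]. *)
Lemma transfer_dist L L' i (phi : X i -> R) (c : R) : positive L ->
    positive L' -> continuous phi ->
    (forall j f, F i j f ->
      `|L j (fun y => phi (f y)) - L' j (fun y => phi (f y))| <= c * m j) ->
  `|transfer L i phi - transfer L' i phi| <= c * m i.
Proof.
move=> posL posL' cphi LL'; rewrite /transfer -sumrB.
apply: le_trans (ler_norm_sum _ _ _) _.
rewrite -[in leRHS]m_eigen mulr_sumr; apply: ler_sum => j _.
have iL := integrable_family j posL cphi.
have iL' := integrable_family j posL' cphi.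
rewrite -(RintegralB (measurable_family i j) iL iL').
have iB : (sigma i j).-integrable (F i j) (EFin \o (fun f : cspace (X j) (X i) =>
    L j (fun y => phi (f y)) - L' j (fun y => phi (f y)))).
  exact: (integrableB (measurable_family i j) iL iL').
have ints : (sigma i j).-integrable (F i j)
    (EFin \o (fun _ : cspace (X j) (X i) => c * m j)).
  exact: (finite_measure_integrable_cst (sigma i j) _ (measurable_family i j)).
have := le_normr_Rintegral (measurable_family i j) iB.
move=> /le_trans; apply.
rewrite mulrCA mulrC -(Rintegral_cst _ (measurable_family i j)).
apply: le_Rintegral => //.
- exact: integrable_norm iB.
- by move=> f; exact: LL'.
Qed.

(** Composition with [f] in [F i j] multiplies the Lipschitz constant of a test function by [r];
    this factor is moved to the distance. *)
Lemma transfer_close c L L' : positive L -> positive L' ->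
  close c L L' -> close (r * c) (transfer L) (transfer L').
Proof.
move=> posL posL' cLL' i K phi K0 lipphi.
rewrite (_ : r * c * K = c * (r * K)); last ring.
apply: transfer_dist => //; first exact: lip_continuous lipphi.
move=> j f Ff; apply: cLL'; first by rewrite mulr_ge0.
move=> x y; apply: le_trans (lipphi _ _) _.
by rewrite (mulrC r) -mulrA ler_wpM2l// F_contraction.
Qed.

Let common_diam : exists2 D : R, 0 <= D & forall i (x y : X i), mdist x y <= D.
Proof.
have /choice[d dP] i : exists d : R, 0 <= d /\ forall x y : X i, mdist x y <= d.
  by have [d d0 dP] := compact_diam (X_compact i); exists d.
have d0 i : 0 <= d i by have [] := dP i.
exists (\sum_i d i) => [|i x y]; first exact: sumr_ge0.
have [_ /(_ x y) xy] := dP i; apply: le_trans xy _.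
by rewrite (bigD1 i)//= lerDl sumr_ge0.
Qed.

(** Both functionals differ from [phi point * m i] by at most the diameter bound times [K * m i],
    hence the constant [D + D]. *)
Lemma normalized_close : exists2 D, 0 <= D &
  forall L L', normalized L -> normalized L' -> close D L L'.
Proof.
have [D D0 DP] := common_diam; exists (D + D); first by rewrite addr_ge0.
move=> L L' [posL L1] [posL' L'1] i K phi K0 lipphi.
have cphi := lip_continuous lipphi; pose c := phi point.
have near_c L0 : positive L0 -> L0 i (fun=> 1) = m i ->
    `|L0 i phi - c * m i| <= D * K * m i.
  move=> posL0 <-; rewrite -pf_cst// -(pf_sub (posL0 i))//; last first.
    exact: cst_continuous.
  apply: (pf_norm_le (posL0 i)).
    by move=> x; apply: cvgB; [exact: cphi|exact: cvg_cst].
  by move=> x; apply: le_trans (lipphi _ _) _; rewrite mulrC ler_wpM2r.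
have := near_c L posL (L1 i); have := near_c L' posL' (L'1 i).
by rewrite !ler_norml; lra.
Qed.

(** Letting [k] grow gives equality on Lipschitz functions, and density extends it to continuous
    ones. *)
Lemma close_eq D L L' i (phi : X i -> R) : normalized L -> normalized L' ->
  (forall k, close (r ^+ k * D) L L') -> continuous phi -> L i phi = L' i phi.
Proof.
move=> [posL L1] [posL' L'1] LL' cphi.
apply/eqP; rewrite -subr_eq0 -normr_le0; apply/ler_addgt0Pr => e e0.
(* Each functional contributes an approximation error [d * m i], and the two add up to [e]. *)
rewrite add0r; pose d := e / (m i + m i).
have m2 : 0 < m i + m i by rewrite addr_gt0.
have d0 : 0 < d by rewrite divr_gt0.
have [K [psi [K0 lippsi phipsi]]] := lip_dense (X_compact i) cphi d0.
have cpsi := lip_continuous lippsi.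
have eq_psi : L i psi = L' i psi.
  apply/eqP; rewrite -subr_eq0 -normr_le0.
  apply: (@geometric_le0 _ r _ (D * K * m i)) => // k.
  by rewrite !mulrA; apply: LL'.
have near_psi L0 : positive L0 -> L0 i (fun=> 1) = m i ->
    `|L0 i phi - L0 i psi| <= d * m i.
  move=> posL0 <-; rewrite -pf_sub//; apply: (pf_norm_le (posL0 i)) => //.
  by move=> x; apply: cvgB; [exact: cphi|exact: cpsi].
have := near_psi L posL (L1 i); have := near_psi L' posL' (L'1 i).
have : d * (m i + m i) = e by rewrite /d divfK// gt_eqF.
by rewrite eq_psi !ler_norml; lra.
Qed.

Definition transfer_fixed L := forall i phi, continuous phi ->
  L i phi = transfer L i phi.

(** Each application of [transfer] fixes both tuples and improves their distance by the factor
    [r]. *)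
Lemma transfer_fixed_unique L L' i (phi : X i -> R) :
  normalized L -> normalized L' -> transfer_fixed L -> transfer_fixed L' ->
  continuous phi -> L i phi = L' i phi.
Proof.
move=> nL nL' fL fL'; have [D D0 cD] := normalized_close.
apply: (close_eq (D := D)) => //; elim=> [|k IH].
  by rewrite expr0 mul1r; exact: cD.
move=> j K psi K0 lippsi; have cpsi := lip_continuous lippsi.
rewrite fL// fL'// exprS -(mulrA r).
exact: (transfer_close nL.1 nL'.1 IH).
Qed.

(** If [psi] vanishes on [W], so does its composition with every [f] of the system, with Lipschitz
    constant multiplied by [r]. The bound on such functions therefore contracts at each application
    of [transfer]. *)
Lemma transfer_fixed_vanish L (W : forall i, set (X i)) :
    normalized L -> transfer_fixed L -> (forall i, W i !=set0) ->
    (forall i j f x, F i j f -> W j x -> W i (f x)) ->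
  forall i K phi, 0 <= K -> lip K phi -> (forall x, W i x -> phi x = 0) ->
    L i phi = 0.
Proof.
move=> [posL L1] fL W0 FW i K phi K0 lipphi Wphi.
have [D D0 DP] := common_diam.
suff bound k : forall j C (psi : X j -> R), 0 <= C -> lip C psi ->
    (forall x, W j x -> psi x = 0) -> `|L j psi| <= r ^+ k * D * C * m j.
  apply/eqP; rewrite -normr_le0.
  apply: (@geometric_le0 _ r _ (D * K * m i)) => // k.
  by rewrite !mulrA; apply: bound.
elim: k => [|k IH] j C psi C0 lippsi Wpsi.
  (* A function that vanishes at some point [w] is bounded by its Lipschitz constant times the
     diameter. *)
  rewrite expr0 mul1r -(L1 j); apply: (pf_norm_le (posL j)) => [|x].
    exact: lip_continuous lippsi.
  have [w Ww] := W0 j; rewrite -[psi x]subr0 -(Wpsi w Ww).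
  by apply: le_trans (lippsi _ _) _; rewrite mulrC ler_wpM2r.
(* The absolute value of [L j psi] is a distance to the zero tuple, which [transfer] fixes, so
   [transfer_dist] applies. *)
pose zero : functionals := fun _ _ => 0.
have pos0 : positive zero.
  move=> l; split=> [? ? _ _|c ? _|//]; rewrite /zero; first by rewrite addr0.
  by rewrite mulr0.
have cpsi := lip_continuous lippsi.
have -> : L j psi = transfer L j psi - transfer zero j psi.
  rewrite fL// [X in _ - X]big1 ?subr0// => l _.
  by rewrite (Rintegral_cst _ (measurable_family j l)) mul0r.
apply: transfer_dist => // l f Ff; rewrite subr0.
rewrite (_ : _ * C = r ^+ k * D * (r * C)); last by rewrite exprS; ring.
apply: IH; first by rewrite mulr_ge0.
  move=> x y; apply: le_trans (lippsi _ _) _.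
  by rewrite (mulrC r) -mulrA ler_wpM2l// F_contraction.
by move=> x Wx; apply: Wpsi; exact: FW Wx.
Qed.

(** The iteration starts from point masses of weight [m i]. *)
Let L0 : functionals := fun i phi => m i * phi point.

Let L0_normalized : normalized L0.
Proof.
split=> i; last by rewrite /L0 mulr1.
split.
- by move=> phi psi _ _; exact: mulrDr.
- by move=> c phi _; exact: mulrCA.
- by move=> phi _ phi0; apply: mulr_ge0 => //; exact: ltW.
Qed.

Let iterates k := iter k transfer L0.
Arguments iterates : clear implicits.

Let iterates_normalized k : normalized (iterates k).
Proof. by elim: k => //= k; exact: transfer_normalized. Qed.

(** Iterates [p] and 0 are both normalized, hence at distance at most [D] uniformly in [p]; then
    [transfer] is applied [k] times. *)
Let iterates_close : exists2 D, 0 <= D &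
  forall k p, close (r ^+ k * D) (iterates (k + p)) (iterates k).
Proof.
have [D D0 cD] := normalized_close; exists D => // k p.
elim: k => [|k IH]; first by rewrite expr0 mul1r; exact: cD.
rewrite addSn exprS -mulrA.
by apply: transfer_close IH; exact: (iterates_normalized _).1.
Qed.

Let iterates_cvg i (phi : X i -> R) : continuous phi ->
  cvgn (fun k => iterates k i phi).
Proof.
move=> cphi; apply/cauchy_cvgP/cauchy_exP => e e0.
have [D D0 cD] := iterates_close.
have m4 : 0 < 4 * m i by rewrite mulr_gt0.
(* The Cauchy estimate has three terms: two approximations by [psi], each costing [d * m i = e / 4],
   and the distance between iterates at [psi], below [e / 4] for the chosen [k]. *)
pose d := e / (4 * m i); have d0 : 0 < d by rewrite divr_gt0.
have de : d * (4 * m i) = e by rewrite /d divfK// gt_eqF.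
have [K [psi [K0 lippsi phipsi]]] := lip_dense (X_compact i) cphi d0.
have cpsi := lip_continuous lippsi.
have [k kP] : exists k, r ^+ k * (D * K * m i) < e / 4.
  apply: contrapT => /forallNP nk.
  suff : e / 4 <= 0 by lra.
  apply: (@geometric_le0 _ r _ (D * K * m i)) => // k.
  by rewrite leNgt; apply/negP.
exists (iterates k i phi); exists k => // q /= kq.
rewrite -(subnKC kq); move: (q - k)%N => p {q kq}.
have near_psi q : `|iterates q i phi - iterates q i psi| <= d * m i.
  have [posq q1] := iterates_normalized q.
  rewrite -(q1 i) -pf_sub//; apply: (pf_norm_le (posq i)) => //.
  by move=> x; apply: cvgB; [exact: cphi|exact: cpsi].
have := near_psi k; have := near_psi (k + p)%N.
have := cD k p i K psi K0 lippsi; move: kP; rewrite !mulrA.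
rewrite /ball /= ltr_norml !ler_norml; lra.
Qed.

Let limit : functionals := fun i phi => limn (fun k => iterates k i phi).
Arguments limit : clear implicits.

Let limit_cvg i (phi : X i -> R) : continuous phi ->
  (fun k => iterates k i phi) @ \oo --> limit i phi.
Proof. exact: iterates_cvg. Qed.

Let limit_normalized : normalized limit.
Proof.
split=> i; last first.
  apply: cvg_lim => //; under eq_fun do rewrite (iterates_normalized _).2.
  exact: cvg_cst.
split.
- move=> phi psi cphi cpsi; apply: cvg_lim => //.
  under eq_fun do rewrite (pf_add ((iterates_normalized _).1 i))//.
  by apply: cvgD; exact: limit_cvg.
- move=> c phi cphi; apply: cvg_lim => //.
  under eq_fun do rewrite (pf_scale ((iterates_normalized _).1 i))//.
  by apply: cvgM; [exact: cvg_cst|exact: limit_cvg].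
- move=> phi cphi phi0; apply: limr_ge; first exact: iterates_cvg.
  by apply: nearW => k; exact: (pf_ge0 ((iterates_normalized k).1 i)).
Qed.

(** This is [iterates_close] as [p] tends to infinity. *)
Let limit_close : exists2 D, 0 <= D &
  forall k, close (r ^+ k * D) limit (iterates k).
Proof.
have [D D0 cD] := iterates_close; exists D => // k i K phi K0 lipphi.
apply/ler_addgt0Pr => e e0.
have /cvgrPdist_le/(_ e e0)[q _ qP] := limit_cvg (lip_continuous lipphi).
have := qP (k + q)%N (leq_addl _ _); have := cD k q i K phi K0 lipphi.
by rewrite /= !ler_norml; lra.
Qed.

(** Both [limit] and [transfer limit] are close to iterate [k.+1], for every [k], so [close_eq]
    identifies them on continuous functions. *)
Lemma transfer_fixed_exists : exists2 L, normalized L & transfer_fixed L.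
Proof.
exists limit => // i phi cphi; have [D D0 cD] := limit_close.
apply: (close_eq (D := D + D)) => //; first exact: transfer_normalized.
(* The comparison at iterate [k.+1] yields the exponent [k.+1]; as [r] is below 1, this implies the
   bound with exponent [k]. *)
move=> k; suff c1 : close (r ^+ k.+1 * (D + D)) limit (transfer limit).
  move=> j K psi K0 lippsi; apply: le_trans (c1 j K psi K0 lippsi) _.
  rewrite -!mulrA ler_wpM2r ?mulr_ge0 ?addr_ge0// ?(ltW (m_gt0 j))//.
  by rewrite exprS ler_piMl ?exprn_ge0// ltW//; have /andP[] := r01.
move=> j K psi K0 lippsi; have := cD k.+1 j K psi K0 lippsi.
have := transfer_close limit_normalized.1 (iterates_normalized k).1 (cD k)
  K0 lippsi.
by rewrite mulrA -exprS /= !ler_norml; lra.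
Qed.

End transfer_operator.
Arguments measurable_family {R n X F} F_compact i j.
Arguments integrable_family {R n X} X_compact {F} F_compact sigma [L i] j [phi].
Arguments transfer {R n X} F sigma L i phi.
Arguments transfer_fixed {R n X} F sigma L.

Lemma Rintegral_mass {R : realType} {T : ptopologicalType}
  (mu : {finite_measure set (borel T) -> \bar R}) :
  \int[mu]_x (1 : R) = fine (mu setT).
Proof. by rewrite Rintegral_cst// mul1r. Qed.

(** * Invariant measures as fixed tuples of functionals *)

Section invariant_measures.
Context {R : realType} {n : nat} {X : 'I_n -> pmetricType R}.
Hypothesis X_compact : forall i, compact [set: X i].
Arguments X_compact : clear implicits.
Context (omega : forall i, {finite_measure set (borel (X i)) -> \bar R}).

Definition integrals : functionals (X := X) :=
  fun i phi => \int[omega i]_x phi x.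
Arguments integrals : clear implicits.

Lemma integrals_positive : positive integrals.
Proof. by move=> i; exact: Rintegral_positive_functional (X_compact i). Qed.

Lemma integrals_normalized (m : 'I_n -> R) :
  (forall i, omega i setT = (m i)%:E) -> normalized m integrals.
Proof.
move=> omegam; split; first exact: integrals_positive.
by move=> i; rewrite /integrals Rintegral_mass omegam.
Qed.

(** Continuous functions on the compact spaces are bounded and the measures are finite, so all the
    extended real integrals are finite and agree with the real ones. *)
Lemma is_invariantE (F : forall i j : 'I_n, set (cspace (X j) (X i)))
    (sigma : forall i j : 'I_n,
      {finite_measure set (borel (cspace (X j) (X i))) -> \bar R}) :
  (forall i j, compact (F i j)) ->
  is_invariant F sigma omega <-> transfer_fixed F sigma integrals.
Proof.
move=> F_compact.
have intE i (phi : X i -> R) : continuous phi ->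
    (\int[omega i]_x (phi x)%:E = (integrals i phi)%:E)%E.
  move=> cphi; rewrite /integrals /Rintegral fineK//.
  have [M _ phiM] := compact_bound (X_compact i) cphi.
  apply: integrable_fin_num => //.
  by apply: (@borel_integrable _ _ (omega i) _ _ M) => // x _; exact: phiM.
have transferE i (phi : X i -> R) : continuous phi ->
  (\sum_(j < n) \int[sigma i j]_(f in F i j) \int[omega j]_x (phi (f x))%:E =
   (transfer F sigma integrals i phi)%:E)%E.
  move=> cphi; rewrite /transfer -sumEFin; apply: eq_bigr => j _.
  have mF := measurable_family F_compact i j.
  have intF := integrable_family X_compact F_compact sigma j integrals_positive cphi.
  rewrite /Rintegral fineK; last exact: (integrable_fin_num mF intF).
  apply: eq_integral => f _; rewrite intE//.
  exact: comp_cspace_continuous.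
split=> [inv i phi cphi|fixL i phi cphi].
  by apply: EFin_inj; rewrite -intE// -transferE//; exact: inv.
by rewrite intE// transferE// fixL.
Qed.

End invariant_measures.
Arguments integrals {R n X} omega i phi.

(* A measure on F i j is represented by a Borel measure on C(X_j, X_i) that
   vanishes outside F i j: F i j may be empty, and the library has no
   measurable structure on an empty type. *)
Theorem theorem4p4 (R : realType) (n : nat) (n_gt0 : (0 < n)%N)
    (X : 'I_n -> pmetricType R)
    (X_compact : forall i, compact [set: X i])
    (F : forall i j : 'I_n, set (cspace (X j) (X i)))
    (F_admissible : forall i j, admissible (F i j))
    (sigma : forall i j : 'I_n,
      {finite_measure set (borel (cspace (X j) (X i))) -> \bar R})
    (sigma_regular : forall i j, regular_measure (sigma i j))
    (sigma_on_F : forall i j, sigma i j (~` F i j) = 0%E)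
    (m : 'cV[R]_n)
    (m_gt0 : forall i, 0 < m i ord0)
    (m_eigen : (\matrix_(i, j) fine (sigma i j (F i j))) *m m = m) :
  exists omega : forall i, {finite_measure set (borel (X i)) -> \bar R},
    [/\ (forall i, regular_measure (omega i)),
        (forall i, omega i setT = (m i ord0)%:E) &
        is_invariant F sigma omega] /\
    (forall omega' : forall i, {finite_measure set (borel (X i)) -> \bar R},
      [/\ (forall i, regular_measure (omega' i)),
          (forall i, omega' i setT = (m i ord0)%:E) &
          is_invariant F sigma omega'] ->
      forall i (A : set (borel (X i))), measurable A -> omega' i A = omega i A) /\
    (forall W : forall i, set (X i), is_attractor F W ->
      msupport (T := prod_topology X) (product_measure omega) `<=` box W).
Proof.
have F_compact i j : compact (F i j) by have [] := F_admissible i j.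
have [r r01 F_contraction] : exists2 r : R, 0 <= r < 1 & forall i j f, F i j f ->
    forall x y, mdist (f x) (f y) <= r * mdist x y.
  have /choice[s sP] (p : 'I_n * 'I_n) : exists s : R, 0 <= s < 1 /\
      forall f, F p.1 p.2 f -> forall x y, mdist (f x) (f y) <= s * mdist x y.
    by have [_ [s s01 sF]] := F_admissible p.1 p.2; exists s.
  (* There are finitely many pairs, so the largest of their contraction constants is still below
     1. *)
  exists (\big[Num.max/0]_p s p) => [|i j f Ff x y].
    rewrite bigmax_ge_id/=; apply: bigmax_lt => // p _.
    by have [/andP[]] := sP p.
  have [_ /(_ f Ff x y) fxy] := sP (i, j); apply: le_trans fxy _.
  by rewrite ler_wpM2r ?mdist_ge0//; exact: (le_bigmax _ s (i, j)).
have eigen i : \sum_(j < n) fine (sigma i j (F i j)) * m j ord0 = m i ord0.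
  have := congr1 (fun v : 'cV[R]_n => v i ord0) m_eigen; rewrite mxE.
  by under eq_bigr do rewrite mxE.
have [L [posL L1] fixL] :=
  transfer_fixed_exists X_compact F_compact r01 F_contraction m_gt0 eigen.
pose omega i := sval (cid (riesz_representation (X_compact i) (posL i))).
have omega_regular i : regular_measure (omega i).
  by rewrite /omega; case: cid => mu [].
have omegaL i phi : continuous phi -> integrals omega i phi = L i phi.
  by rewrite /integrals /omega; case: cid => mu [_ /=]; exact.
have omega_mass i : omega i setT = (m i ord0)%:E.
  rewrite -(L1 i) -omegaL; last exact: cst_continuous.
  by rewrite /integrals Rintegral_mass fineK// fin_num_measure.
have omega_fixed : transfer_fixed F sigma (integrals omega).
  move=> i phi cphi; rewrite omegaL// fixL//; apply: eq_bigr => j _.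
  by apply: eq_Rintegral => f _; rewrite omegaL//; exact: comp_cspace_continuous.
have omega_norm := integrals_normalized X_compact omega_mass.
exists omega; split; [|split].
- by split => //; apply/is_invariantE.
- move=> omega' [_ mass' /is_invariantE fix'] i A mA.
  apply: lip_measure_unique mA => K phi _ lipphi.
  apply: (transfer_fixed_unique X_compact F_compact r01 F_contraction m_gt0 eigen
    (L := integrals omega') (L' := integrals omega)) => //.
  + exact: integrals_normalized.
  + exact: fix'.
  + exact: lip_continuous lipphi.
(* If [x i] lies outside [W i], the cylinder over the complement of [W i] is an open neighbourhood
   of [x] of product measure 0, against the choice of [x] in the support. *)
- move=> W attrW x suppx i; apply: contrapT => nWx.
  have W0 j : W j !=set0 by have [] := attrW j.
  have FW j k f y : F j k f -> W k y -> W j (f y).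
    move=> Ff Wy; have [_ _ ->] := attrW j.
    by exists k => //; exists f => //; exists y.
  have cW : closed (W i).
    apply: compact_closed; first exact: metric_hausdorff.
    by have [] := attrW i.
  have omegaW : omega i (~` W i) = 0%E.
    apply: measure0_lip_test => // K phi K0 lipphi phi0.
    exact: (transfer_fixed_vanish X_compact F_compact r01 F_contraction
      eigen omega_norm omega_fixed W0 FW K0 lipphi phi0).
  (* Written as a box, the cylinder has the measure given by the product formula, where the [i]-th
     factor is 0. *)
  pose A : forall j, set (X j) := dfwith (fun=> setT) i (~` W i).
  have UE : box A = [set y : prod_topology X | (~` W i) (y i)].
    apply/seteqP; split=> [y /(_ i)|y nWy j]; rewrite /A; first by rewrite dfwithin.
    by case: dfwithP.
  have mA j : measurable (A j : set (borel (X j))).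
    rewrite /A; case: dfwithP => [|k _]; last exact: measurableT.
    by apply: borel_open; exact: closed_openC.
  have oU : open (box A : set (prod_topology X)).
    rewrite UE; apply: (@open_comp (prod_topology X) (X i) (fun y => y i) (~` W i))
      => [y _|].
      exact: proj_continuous.
    exact: closed_openC.
  have Ax : box A x by rewrite UE.
  have Ai0 : omega i (A i) = 0%E by rewrite /A dfwithin.
  have := suppx _ oU Ax; rewrite (product_measureE omega mA).
  by rewrite (bigD1 i)//= Ai0 mul0e ltxx.
Qed.
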